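(* $$\sigma(\oplus\text{Hitting Set}/n)=\sigma(\oplus\text{Set Cover}/n).$$
   Context: For a problem $\Pi$ with input size $m$ and parameter $n$, $\sigma(\Pi/n)$ is the infimum of all $\epsilon>0$ such that $\Pi$ has a randomized algorithm with error probability at most $1/3$ running in time $2^{\epsilon n}\mathrm{poly}(m)$. $\oplus$Hitting Set: given $\mathcal F\subseteq 2^U$ with $|U|=n$, $|\mathcal F|=m$, decide whether the number of $H\subseteq U$ with $H\cap S\ne\emptyset$ for every $S\in\mathcal F$ is odd. $\oplus$Set Cover: given $\mathcal F\subseteq 2^U$ with $|U|=n$, $|\mathcal F|=m$, decide whether the number of $\mathcal C\subseteq\mathcal F$ with $\bigcup_{S\in\mathcal C}S=U$ is odd. *)

(* Defs.v *)
From HB Require Import structures.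
From mathcomp Require Import all_boot all_order all_algebra.
From mathcomp Require Import classical_sets reals ereal exp.
(* Again, so that set0 and setT denote finite sets. *)
From mathcomp Require Import finset.

Set Implicit Arguments.
Unset Strict Implicit.
Unset Printing Implicit Defensive.

Import Order.TTheory GRing.Theory Num.Theory.

(* The model of computation is a randomized random access machine under the
   logarithmic cost criterion.  Memory is an infinite array M of naturals,
   initially 0, and the input x is a separate read-only array.  Registers named
   in the program text are constants of the program; only Fetch, Store and Input
   use computed addresses. *)
Inductive instr : Type :=
| Const of nat & nat          (* Const d k : M[d] := k *)
| Plus of nat & nat & nat      (* Plus d a b : M[d] := M[a] + M[b] *)
| Minus of nat & nat & nat      (* Minus d a b : M[d] := M[a] - M[b], truncated *)
| Fetch of nat & nat           (* Fetch d a : M[d] := M[M[a]] *)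
| Store of nat & nat          (* Store a b : M[M[a]] := M[b] *)
| Input of nat & nat          (* Input d a : M[d] := x[M[a]] *)
| Flip of nat                 (* Flip d : M[d] := a fair random bit *)
| Jz of nat & nat             (* Jz a l : if M[a] = 0, jump to instruction l *)
| Halt of bool.               (* Halt b : stop with answer b *)

Definition program := seq instr.

Definition upd (M : nat -> nat) (a v : nat) : nat -> nat :=
  fun i => if i == a then v else M i.

(* Length of the binary expansion of k, with bitlen 0 = 1. *)
Definition bitlen (k : nat) : nat := (trunc_log 2 k).+1.

(* Every instruction costs at least 1.  The lengths of addresses fixed in the
   program text are bounded for each program and are not charged. *)
Definition cost (x M : nat -> nat) (i : instr) : nat :=
  match i with
  | Const d k => bitlen k
  | Plus d a b => bitlen (M a) + bitlen (M b)
  | Minus d a b => bitlen (M a) + bitlen (M b)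
  | Fetch d a => bitlen (M a) + bitlen (M (M a))
  | Store a b => bitlen (M a) + bitlen (M b)
  | Input d a => bitlen (M a) + bitlen (x (M a))
  | Flip d => 1
  | Jz a l => bitlen (M a)
  | Halt b => 1
  end.

Definition exec_mem (x : nat -> nat) (coin : bool) (i : instr)
    (M : nat -> nat) : nat -> nat :=
  match i with
  | Const d k => upd M d k
  | Plus d a b => upd M d (M a + M b)
  | Minus d a b => upd M d (M a - M b)
  | Fetch d a => upd M d (M (M a))
  | Store a b => upd M (M a) (M b)
  | Input d a => upd M d (x (M a))
  | Flip d => upd M d coin
  | Jz _ _ | Halt _ => M
  end.

Definition exec_pc (i : instr) (M : nat -> nat) (pc : nat) : nat :=
  if i is Jz a l then (if M a == 0 then l else pc.+1) else pc.+1.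

(* One coin of [coins] is supplied per step, and only Flip looks at it.  The
   result is the answer together with the total cost, or None if the machine
   has not halted after size coins steps.  Leaving the program text is
   a rejecting halt. *)
Fixpoint run (P : program) (x : nat -> nat) (coins : seq bool)
    (pc : nat) (M : nat -> nat) : option (bool * nat) :=
  if coins is coin :: coins' then
    let i := nth (Halt false) P pc in
    if i is Halt b then Some (b, cost x M i)
    else if run P x coins' (exec_pc i M pc) (exec_mem x coin i M) is Some (b, t)
    then Some (b, cost x M i + t)
    else None
  else None.

(* Input cells beyond the end of the input word read 0. *)
Definition outcome (P : program) (x : seq nat) (coins : seq bool) :
    option (bool * nat) :=
  run P (nth 0 x) coins 0 (fun=> 0).

(* Worst case over the coins.  As each step costs at least 1, a computation of
   cost at most T takes at most T steps, so T coins suffice. *)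
Definition halts_within (P : program) (x : seq nat) (T : nat) : Prop :=
  forall coins : T.-tuple bool,
    exists b t, outcome P x coins = Some (b, t) /\ t <= T.

Definition answers (P : program) (x : seq nat) (coins : seq bool) (b : bool) :
    bool :=
  if outcome P x coins is Some (b', _) then b' == b else false.

Local Open Scope ring_scope.

Definition error_prob (R : realType) (P : program) (x : seq nat) (T : nat)
    (b : bool) : R :=
  #|[pred coins : T.-tuple bool | ~~ answers P x coins b]|%:R
    / #|{: T.-tuple bool}|%:R.

(* A parameterized decision problem.  An instance may have several encodings,
   and an algorithm has to succeed on all of them. *)
Record problem := Problem {
  instance : Type;
  encodes : instance -> seq nat -> Prop;
  input_size : instance -> nat;
  parameter : instance -> nat;
  yes : instance -> bool }.

Definition solvable_with_exponent (R : realType) (Pi : problem) (eps : R) :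
    Prop :=
  exists (P : program) (p : {poly nat}),
    forall (I : instance Pi) (x : seq nat), encodes I x ->
      exists T : nat,
        [/\ T%:R <= 2 `^ (eps * (parameter I)%:R) * p.[input_size I]%:R,
            halts_within P x T
          & error_prob R P x T (yes I) <= 1 / 3].

(* Taken in the extended reals, so that the infimum of the empty set is +oo. *)
Definition sigma (R : realType) (Pi : problem) : \bar R :=
  ereal_inf [set eps%:E | eps in
    [set eps : R | 0 < eps /\ solvable_with_exponent Pi eps]]%classic.

Record set_family := SetFamily {
  universe : finType;
  members : {set {set universe}} }.

(* The word consisting of |U|, |F| and the rows of the incidence matrix of
   F, for an arbitrary ordering of U and of F. *)
Definition encodes_set_family (I : set_family) (x : seq nat) : Prop :=
  exists (us : seq (universe I)) (Fs : seq {set universe I}),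
    [/\ perm_eq us (enum (universe I)),
        perm_eq Fs (enum (members I))
      & x = [:: #|universe I|, #|members I|
              & [seq nat_of_bool (u \in A) | A : {set universe I} <- Fs,
                                             u : universe I <- us]]].

Definition is_hitting_set (I : set_family) (H : {set universe I}) : bool :=
  [forall A in members I, H :&: A != set0].

Definition is_set_cover (I : set_family) (C : {set {set universe I}}) : bool :=
  (C \subset members I) && (\bigcup_(A in C) A == [set: universe I]).

Definition set_family_problem (yes : set_family -> bool) : problem :=
  {| instance := set_family;
     encodes := encodes_set_family;
     input_size := fun I => #|members I|;
     parameter := fun I => #|universe I|;
     yes := yes |}.

Definition parity_hitting_set : problem :=
  set_family_problem
    (fun I => odd #|[pred H : {set universe I} | is_hitting_set H]|).

Definition parity_set_cover : problem :=
  set_family_problem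
    (fun I => odd #|[pred C : {set {set universe I}} | is_set_cover C]|).

(* Main.v *)
Require Import Defs.
From mathcomp Require Import all_boot.
From mathcomp Require Import boolp reals.

(** The two problems have the same answer on every instance.  Count modulo 2
    the pairs [(H, C)] with [C] a subfamily of [F] and [H] disjoint from the
    union of [C].  A given [H] occurs in [2 ^ k] pairs, where [k] is the number
    of members of [F] that [H] misses, which is odd iff [H] is a hitting set.
    A given [C] occurs in [2 ^ k] pairs, where [k] is the number of points that
    [C] leaves uncovered, which is odd iff [C] is a set cover. *)

Set Implicit Arguments.
Unset Strict Implicit.
Unset Printing Implicit Defensive.

Lemma odd_sum_expn2 (T : finType) (P : pred T) (k : T -> nat) :
  odd (\sum_(i | P i) 2 ^ k i) = odd #|[pred i | P i & k i == 0]|.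
Proof.
rewrite -sum1_card big_mkcondr /= !(big_morph odd oddD (erefl _)).
by apply: eq_bigr => i _; rewrite oddX orbF; case: eqP.
Qed.

Section ParityHittingSetCover.
Variable I : set_family.
Implicit Types (A H : {set universe I}) (C : {set {set universe I}}).

Let missed H := [set A in members I | [disjoint H & A]].
Let uncovered C := ~: \bigcup_(A in C) A.

(** Both sides say that [C] consists of members of the family, each disjoint from [H]; these are the
    pairs to be counted. *)
Lemma sub_missed_uncovered H C :
  (C \subset missed H) = (C \subset members I) && (H \subset uncovered C).
Proof.
rewrite -disjoints_subset.
apply/subsetP/andP => [sub | [/subsetP CF /bigcup_disjointP dis] A AC].
  split; first by apply/subsetP => A /sub; rewrite inE => /andP[].
  by apply/bigcup_disjointP => A /sub; rewrite inE => /andP[].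
by rewrite inE CF // dis.
Qed.

Lemma sum_missed_uncovered :
  \sum_H 2 ^ #|missed H| =
    \sum_(C : {set {set universe I}} | C \subset members I) 2 ^ #|uncovered C|.
Proof.
(* Powers of 2 become sizes of powersets, so each sum counts the pairs, one by [H] first and the
   other by [C] first. *)
under eq_bigr => H _ do rewrite -card_powerset -sum1_card.
under [RHS]eq_bigr => C _ do rewrite -card_powerset -sum1_card.
rewrite (exchange_big_dep
  [pred C : {set {set universe I}} | C \subset members I]) /=; last first.
  by move=> H C _; rewrite powersetE sub_missed_uncovered => /andP[].
apply: eq_bigr => C CF; apply: eq_bigl => H.
by rewrite !powersetE sub_missed_uncovered CF.
Qed.

Lemma odd_hitting_set_set_cover :
  odd #|[pred H : {set universe I} | is_hitting_set H]| =
    odd #|[pred C : {set {set universe I}} | is_set_cover C]|.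
Proof.
have -> : #|[pred H : {set universe I} | is_hitting_set H]|
        = #|[pred H : {set universe I} | predT H & #|missed H| == 0]|.
  apply: eq_card => H; rewrite !inE cards_eq0 -subset0.
  apply/forall_inP/subsetP => [hit A | none A AF].
    by rewrite !inE -setI_eq0 => /andP[/hit/negPf->].
  apply/negP; rewrite setI_eq0 => HA.
  by have := none A; rewrite !inE AF HA => /(_ isT).
have -> : #|[pred C : {set {set universe I}} | is_set_cover C]|
        = #|[pred C : {set {set universe I}} |
              C \subset members I & #|uncovered C| == 0]|.
  apply: eq_card => C; rewrite !inE cards_eq0.
  by rewrite -(inj_eq (@setC_inj _)) setC0 setCK.
by rewrite -!odd_sum_expn2 sum_missed_uncovered.
Qed.

End ParityHittingSetCover.

Theorem theorem16 (R : realType) :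
  sigma R parity_hitting_set = sigma R parity_set_cover.
Proof.
(* The problems share encoding, size and parameter, so it suffices that their answers agree on every
   instance. *)
congr (sigma R (set_family_problem _)); apply/funext => I.
exact: odd_hitting_set_set_cover.
Qed.
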